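(* For every integer $n\ge 1$, the $3$-adic valuation of the denominator $\gamma_n$ of $G_n(x)$ is $$\nu_3(\gamma_n)=\begin{cases}\nu_3(\operatorname{lcm}(1,2,\dots,n))-1 & \text{if } n=2\cdot 3^m \text{ for some integer } m\ge 1,\\ \nu_3(\operatorname{lcm}(1,2,\dots,n)) & \text{otherwise.}\end{cases}$$
   Context: For $n\ge1$ define $$G_n(x)=-2i\sum_{k=0}^{\lfloor n/2\rfloor-1}(-1)^k\left[\sum_{j=2k+1}^{n-1}\frac{1}{(n-j)(n-j+1)}\binom{j}{2k+1}\right]x^{n-2k},$$ where $i=\sqrt{-1}$ and an empty sum is $0$. All coefficients of $G_n$ are rational multiples of $i$. The denominator $\gamma_n$ of $G_n$ is the least positive integer $d$ such that all coefficients of $d\,G_n(x)$ lie in $i\mathbb{Z}$ (so $\gamma_1=1$). $\nu_p(m)$ denotes the exponent of the highest power of the prime $p$ dividing $m$. *)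

(* Defs.v *)
From mathcomp Require Import all_boot all_order all_algebra all_field.
From mathcomp Require Import ring.

Set Implicit Arguments.
Unset Strict Implicit.
Unset Printing Implicit Defensive.

Import Order.TTheory GRing.Theory Num.Theory.
Local Open Scope ring_scope.

(* The subtractions [n - j] and [n - 2 * k] are over nat, but never truncate:
   [j < n] and [k < n./2] on the ranges of summation. *)
Definition G (n : nat) : {poly algC} :=
  (- (2%:R * 'i)) *:
  \sum_(0 <= k < n./2)
    ((-1) ^+ k *
     \sum_(2 * k + 1 <= j < n)
       1 / ((n - j)%N%:R * (n - j + 1)%N%:R) * 'C(j, 2 * k + 1)%:R)
    *: 'X^(n - 2 * k).

Definition iZ : {pred algC} := [pred z | z / 'i \is a Num.int].

Lemma iZP (z : algC) : reflect (exists m : int, z = 'i * m%:~R) (z \in iZ).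
Proof.
rewrite inE; apply: (iffP intrP) => -[m zm]; exists m.
  by rewrite -zm mulrC divfK ?neq0Ci.
by rewrite zm mulrC mulKf ?neq0Ci.
Qed.

Definition clears_denominators (n d : nat) : bool :=
  (0 < d)%N && (d%:R *: G n \is a polyOver iZ).

Lemma clears_denominatorsP (n d : nat) :
  reflect ((0 < d)%N /\
           forall i : nat, exists m : int, (d%:R *: G n)`_i = 'i * m%:~R)
          (clears_denominators n d).
Proof.
apply: (iffP andP) => -[d_gt0 H]; split=> //.
  move=> i; have [lt_i|le_i] := ltnP i (size (d%:R *: G n)).
    by apply/iZP; move/(all_nthP 0): H => H; exact: H.
  by exists 0; rewrite mulr0 nth_default.
by apply/(all_nthP 0) => i _; apply/iZP.
Qed.

Lemma clears_denominators_ex (n : nat) : exists d, clears_denominators n d.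
Proof.
pose w j := ((n - j) * (n - j + 1))%N.
pose D := (\prod_(0 <= j < n) w j)%N.
have w_gt0 j : (j < n)%N -> (0 < w j)%N.
  by move=> jn; rewrite /w muln_gt0 subn_gt0 jn addn1.
exists D; apply/clears_denominatorsP; split.
  rewrite /D big_nat_cond; apply: prodn_cond_gt0 => j.
  by rewrite andbT => /andP[_ /w_gt0].
move=> i; apply/iZP; rewrite inE /G scalerA coefZ coef_sum mulr_sumr mulr_suml.
apply: rpred_sum => k _; rewrite coefZ coefXn.
set S := \sum_(_ <= j < n) _; set b := (i == _)%:R.
have DS : D%:R * S \is a Num.int.
  rewrite /S mulr_sumr big_nat_cond; apply: rpred_sum => j.
  rewrite andbT => /andP[_ jn]; rewrite mulrA rpredM ?rpred_nat //.
  have wD : (w j %| D)%N.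
    rewrite /D big_mkord (bigD1 (Ordinal jn)) //=; exact: dvdn_mulr.
  rewrite -natrM -/(w j) -(divnK wD) natrM mul1r mulfK ?rpred_nat //.
  by rewrite pnatr_eq0 -lt0n w_gt0.
have -> : D%:R * - (2%:R * 'i) * ((-1) ^+ k * S * b) / 'i
          = - 2%:R * (-1) ^+ k * b * (D%:R * S) * ('i / 'i) by ring.
rewrite divff ?neq0Ci // mulr1; apply: rpredM => //; apply: rpredM; last exact: rpred_nat.
by apply: rpredM; rewrite ?rpred_sign // rpredN rpred_nat.
Qed.

Definition gamma (n : nat) : nat := ex_minn (clears_denominators_ex n).

Definition lcm_upto (n : nat) : nat := \big[lcmn/1%N]_(1 <= k < n.+1) k.

(* Main.v *)
Require Import Defs.
From mathcomp Require Import all_boot all_order all_algebra all_field.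
From mathcomp Require Import ring zify.

(* Abel summation turns the coefficient of index [r = s + 1] into
   [C(n, r) - sum_(1 <= m <= n) C(n - m, s) / m].  Multiplied by [q = 3 ^ e], this sum is
   congruent modulo [3] to [sum_(c <= n / q) C(n - c q, s) / c].  For the largest
   [q <= n] there are at most two terms.  If [n < 2 q], taking [s = 0] gives a unit.
   If [n = 2 q + t] the value is [C(t + q, s) - C(t, s)] modulo [3]: it is a unit for
   some even [s] when [t > 0], and vanishes for every even [s] when [t = 0].  In the
   latter case the next power [q / 3], with [s = 0], leaves the harmonic number
   [H_6 = 49 / 20], a 3-adic unit. *)

Set Implicit Arguments.
Unset Strict Implicit.
Unset Printing Implicit Defensive.

Import Order.TTheory GRing.Theory Num.Theory.
Local Open Scope ring_scope.

(** * Valuation of the lcm, and binomial coefficients modulo a prime *)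

Section BinomialModPrime.
Variable p : nat.
Hypothesis p_pr : prime p.

Lemma logn_lcm_upto n : logn p (lcm_upto n) = trunc_log p n.
Proof.
have p_gt1 := prime_gt1 p_pr.
elim: n => [|n IHn]; first by rewrite /lcm_upto big_geq // logn1 trunc_log0.
have lcm_gt0 : (0 < lcm_upto n)%N.
  rewrite /lcm_upto big_nat.
  elim/big_ind: _ => [//|x y x_gt0 y_gt0|i /andP[]//].
  by rewrite lcmn_gt0 x_gt0.
rewrite /lcm_upto big_nat_recr //= logn_lcm // -/(lcm_upto n) IHn.
apply/eqP; rewrite eqn_leq geq_max leq_trunc_log //=; apply/andP; split.
  by apply: trunc_log_max => //; apply: dvdn_leq; rewrite ?pfactor_dvdnn.
rewrite leq_max.
(* Either [n.+1] is itself a power of [p], or the largest power up to [n.+1] is already at most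
   [n]. *)
have := trunc_logP p_gt1 (ltn0Sn n); rewrite leq_eqVlt => /predU1P[eq_n|lt].
  by rewrite -[X in logn p X]eq_n pfactorK // leqnn orbT.
by rewrite trunc_log_max.
Qed.

(** Since [k C(m, k) = m C(m - 1, k - 1)], if [p] did not divide [C(m, k)] then [p ^ e] would divide
    the smaller [k]. *)
Lemma prime_dvd_bin_pow e m k :
  (p ^ e %| m)%N -> (0 < k < p ^ e)%N -> (p %| 'C(m, k))%N.
Proof.
case: m => [|m] pm /andP[k_gt0 k_lt]; first by rewrite bin_small.
apply: contraTT k_lt; rewrite -leqNgt -prime_coprime // => p_bin.
apply: dvdn_leq => //; rewrite -(Gauss_dvdl _ (coprimeXl e p_bin)).
by case: k k_gt0 {p_bin} => // k _; rewrite -mul_bin_diag dvdn_mulr.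
Qed.

(** By Pascal's rule, consecutive entries of row [m - 1] are opposite modulo [p], starting from
    1. *)
Lemma prime_ndvd_bin_pred e m k :
  (0 < m)%N -> (p ^ e %| m)%N -> (k < p ^ e)%N -> ~~ (p %| 'C(m.-1, k))%N.
Proof.
case: m => // m _ pm; elim: k => [|k IHk] k_lt.
  by rewrite bin0 Euclid_dvd1.
have := prime_dvd_bin_pow pm (k := k.+1); rewrite k_lt => /(_ isT).
by rewrite binS => /dvdn_add_eq /= ->; apply/IHk/ltnW.
Qed.

(** With [m = u q] and [q] the [p]-part of [m], [C(m, q) = u C(m - 1, q - 1)], and both factors are
    prime to [p]. *)
Lemma prime_ndvd_bin_logn m : (0 < m)%N -> ~~ (p %| 'C(m, p ^ logn p m))%N.
Proof.
move=> m_gt0; have p_gt0 := prime_gt0 p_pr.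
have [u pu mE] := pfactor_coprime p_pr m_gt0.
move: (pfactor_dvdnn p m); set q := (p ^ logn p m)%N in mE * => qm.
have q_gt0 : (0 < q)%N by rewrite expn_gt0 p_gt0.
have -> : 'C(m, q) = (u * 'C(m.-1, q.-1))%N.
  apply/eqP; rewrite -(eqn_pmul2l q_gt0) mulnCA mulnA -mE.
  by rewrite mul_bin_diag prednK.
rewrite Euclid_dvdM // negb_or -prime_coprime // pu /=.
by apply: (@prime_ndvd_bin_pred (logn p m)); rewrite // prednK.
Qed.
End BinomialModPrime.

(** * Rationals integral at a prime *)

Section IntegralAtPrime.
Variable p : nat.
Hypothesis p_pr : prime p.

(** Membership in the localization of the integers at [p], inside [algC], where the coefficients of
    [G] live. *)
Definition integral_at (x : algC) : Prop :=
  exists2 d : nat, ~~ (p %| d)%N & d%:R * x \is a Num.int.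

Lemma int_integral_at x : x \is a Num.int -> integral_at x.
Proof. by move=> xZ; exists 1%N; rewrite ?Euclid_dvd1 // mul1r. Qed.

Lemma integral_atD x y : integral_at x -> integral_at y -> integral_at (x + y).
Proof.
move=> [d pd dx] [e pe ey]; exists (d * e)%N.
  by rewrite Euclid_dvdM // negb_or pd.
have -> : (d * e)%:R * (x + y) = e%:R * (d%:R * x) + d%:R * (e%:R * y).
  by rewrite natrM; ring.
by rewrite rpredD // rpredM // rpred_nat.
Qed.

Lemma integral_atM x y : integral_at x -> integral_at y -> integral_at (x * y).
Proof.
move=> [d pd dx] [e pe ey]; exists (d * e)%N.
  by rewrite Euclid_dvdM // negb_or pd.
by rewrite natrM mulrACA rpredM.
Qed.

Lemma integral_atN x : integral_at x -> integral_at (- x).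
Proof. by move=> [d pd dx]; exists d; rewrite // mulrN rpredN. Qed.

Lemma integral_atB x y : integral_at x -> integral_at y -> integral_at (x - y).
Proof. by move=> Ix Iy; apply/integral_atD/integral_atN. Qed.

Lemma integral_at_nat k : integral_at k%:R.
Proof. exact/int_integral_at/rpred_nat. Qed.

Lemma integral_at_natV k : ~~ (p %| k)%N -> integral_at k%:R^-1.
Proof.
move=> pk; exists k => //; rewrite divff // pnatr_eq0.
by apply: contraNneq pk => ->; exact: dvdn0.
Qed.

Lemma integral_at_divp k : integral_at (k%:R / p%:R) -> (p %| k)%N.
Proof.
move=> [d pd]; rewrite mulrA -natrM => dk.
suff: (p %| d * k)%N by rewrite Euclid_dvdM // (negPf pd).
rewrite -dvdC_nat /= ; apply/dvdCP; exists ((d * k)%:R / p%:R) => //.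
by rewrite divfK // pnatr_eq0 -lt0n prime_gt0.
Qed.

(* [p ^ e / m] is divisible by [p] unless [p ^ e] divides [m]. *)
Lemma integral_at_sum_inv e (a : nat -> nat) n :
  integral_at ((p ^ e)%:R / p%:R * (\sum_(0 <= m < n) (a m.+1)%:R / m.+1%:R)
    - (\sum_(0 <= c < n %/ p ^ e) (a (c.+1 * p ^ e)%N)%:R / c.+1%:R) / p%:R).
Proof.
have q_gt0 : (0 < p ^ e)%N by rewrite expn_gt0 prime_gt0.
elim: n => [|n IHn].
  by rewrite div0n !big_geq // mulr0 mul0r subr0; apply: (integral_at_nat 0).
rewrite divnS //; case: (boolP (p ^ e %| n.+1)%N) => pn.
  rewrite add1n !big_nat_recr //= mulrDr mulrDl opprD addrACA.
  have nE : ((n %/ p ^ e).+1 * p ^ e = n.+1)%N.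
    by rewrite -[RHS](divnK pn) divnS // pn.
  rewrite nE; have -> : n.+1%:R = (n %/ p ^ e).+1%:R * (p ^ e)%:R :> algC.
    by rewrite -natrM nE.
  set b := (a _)%:R; set c := (n %/ p ^ e).+1.
  have -> : (p ^ e)%:R / p%:R * (b / (c%:R * (p ^ e)%:R)) = b / c%:R / p%:R :> algC.
    by field; rewrite !pnatr_eq0 /= -!lt0n q_gt0 prime_gt0. idtac. 
  by rewrite subrr addr0.
rewrite add0n big_nat_recr //= mulrDr addrAC.
apply: integral_atD => //.
have [u pu nE] := pfactor_coprime p_pr (ltn0Sn n).
have u_gt0 : (0 < u)%N by have := ltn0Sn n; rewrite nE muln_gt0 => /andP[].
set v := logn p n.+1 in nE.
have lt_ve : (v < e)%N by rewrite ltnNge -pfactor_dvdn.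
(* As [v < e], the factor [p ^ e] cancels both [p ^ v] and the extra [p]. *)
have -> : (p ^ e)%:R / p%:R * ((a n.+1)%:R / n.+1%:R)
   = (p ^ (e - v.+1) * a n.+1)%:R * u%:R^-1 :> algC.
  rewrite natrM; set b := (a _)%:R.
  rewrite [in LHS]nE -[e in LHS](subnK lt_ve) addnS expnS expnD !natrM.
  by field; rewrite !pnatr_eq0 -!lt0n u_gt0 expn_gt0 !prime_gt0.
apply: integral_atM; first exact: integral_at_nat.
by apply: integral_at_natV; rewrite -prime_coprime.
Qed.

End IntegralAtPrime.

(** * The coefficients of [G] and the valuation of their denominator *)

Definition weight_sum (n r : nat) : algC :=
  \sum_(r <= j < n) 1 / ((n - j)%N%:R * (n - j + 1)%N%:R) * 'C(j, r)%:R.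

(** Summation by parts: the weight is a difference of consecutive reciprocals, and Pascal's rule
    differences the binomial. *)
Lemma weight_sumE n s :
  weight_sum n s.+1 = 'C(n, s.+1)%:R
    - \sum_(0 <= m < n) 'C(n - m.+1, s)%:R / m.+1%:R.
Proof.
have -> : weight_sum n s.+1 =
    \sum_(0 <= j < n) 1 / ((n - j)%N%:R * (n - j + 1)%N%:R) * 'C(j, s.+1)%:R.
  have [le_sn|lt_ns] := leqP s.+1 n; last first.
    rewrite /weight_sum big_geq ?(ltnW lt_ns) // big_nat big1 // => j /andP[_ jn].
    by rewrite bin_small ?mulr0 // (ltn_trans jn).
  rewrite (big_cat_nat (leq0n _) le_sn) /= [X in X + _]big_nat big1 ?add0r //.
  by move=> j /andP[_ js]; rewrite bin_small ?mulr0.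
rewrite [X in _ = _ - X]big_nat_rev.
rewrite [X in _ = _ - X](eq_big_nat _ _ (F2 := fun j => 'C(j, s)%:R / (n - j)%:R)); last first.
  by move=> j /andP[_ jn] /=; rewrite add0n subnSK // subKn // ltnW.
(* [u j.+1 - u j] is the weighted summand plus [C(j, s) / (n - j)], so both sums combine into a
   telescoping one. *)
pose u j : algC := 'C(j, s.+1)%:R / (n - j).+1%:R.
have -> : 'C(n, s.+1)%:R = u n - u 0%N.
  by rewrite /u subnn divr1 bin0n mul0r subr0.
rewrite -telescope_sumr // -sumrB big_nat [RHS]big_nat; apply: eq_bigr => j /andP[_ jn].
rewrite /u subnSK // binS addn1 [('C(j, s.+1) + _)%:R]natrD.
have x_neq0 : (n - j)%:R != 0 :> algC by rewrite pnatr_eq0 subn_eq0 -ltnNge.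
have : (n - j).+1%:R != 0 :> algC by rewrite pnatr_eq0.
by rewrite -natr1 => x1_neq0; field; rewrite x_neq0.
Qed.

(** Distinct [k] give distinct exponents [n - 2 k], so each coefficient can be tested separately, up
    to a sign and ['i]. *)
Lemma clears_denominatorsE n d :
  clears_denominators n d <->
  (0 < d)%N /\
  forall k, (k < n./2)%N -> d%:R * (2%:R * weight_sum n (2 * k).+1) \is a Num.int.
Proof.
have coefE k : (k < n./2)%N ->
   (d%:R *: G n)`_(n - 2 * k) / 'i
     = - (-1) ^+ k * (d%:R * (2%:R * weight_sum n (2 * k).+1)).
  move=> kn; rewrite /G scalerA coefZ coef_sum (bigD1_seq k) ?mem_index_iota ?iota_uniq //=.
  rewrite [X in _ + X]big_nat_cond [X in _ + X]big1 => [|l /andP[/andP[_ ln] lk]]; last first.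
    rewrite coefZ coefXn; case: eqP => [|_]; last by rewrite mulr0.
    by lia.
  rewrite coefZ coefXn eqxx addr0 mulr1 addn1 -/(weight_sum n _).
  by field; exact: neq0Ci.
split=> [/andP[d_gt0 H]|[d_gt0 H]].
  split=> // k kn.
  have : (d%:R *: G n)`_(n - 2 * k) \in iZ.
    have [lt_i|le_i] := ltnP (n - 2 * k) (size (d%:R *: G n)).
      by move/(all_nthP 0): H => H; exact: H.
    by rewrite inE nth_default // mul0r.
  by rewrite inE coefE // mulNr rpredN rpredMsign.
apply/clears_denominatorsP; split=> // i; apply/iZP; rewrite inE.
have [[k kn ->]|ni] : (exists2 k, (k < n./2)%N & i = (n - 2 * k)%N) \/
  (forall k, (k < n./2)%N -> i != (n - 2 * k)%N).
- have [/existsP[k /eqP ->]|/existsPn ni] := boolP [exists k : 'I_n./2, i == (n - 2 * k)%N].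
    by left; exists k.
  by right=> k kn; apply: (ni (Ordinal kn)).
- by rewrite coefE // mulNr rpredN rpredMsign H.
rewrite /G scalerA coefZ coef_sum big_nat big1 ?mulr0 ?mul0r // => k /andP[_ kn].
by rewrite coefZ coefXn (negPf (ni _ kn)) mulr0.
Qed.

(** Otherwise, lowering the [p]-part of [gamma n] to [p ^ e] would still clear denominators, against
    minimality. *)
Lemma logn_gamma_le p n e : prime p ->
  (forall k, (k < n./2)%N ->
     integral_at p ((p ^ e)%:R * (2%:R * weight_sum n (2 * k).+1))) ->
  (logn p (gamma n) <= e)%N.
Proof.
move=> p_pr He; rewrite /gamma; case: ex_minnP => g /clears_denominatorsE[g_gt0 Hg] g_min.
have [u pu gE] := pfactor_coprime p_pr g_gt0.
rewrite leqNgt; apply/negP=> lt_e.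
have u_gt0 : (0 < u)%N by move: g_gt0; rewrite gE muln_gt0 => /andP[].
have p_gt1 := prime_gt1 p_pr.
have: clears_denominators n (u * p ^ e).
  apply/clears_denominatorsE; split; first by rewrite muln_gt0 u_gt0 expn_gt0 ltnW.
  move=> k kn; have [d pd] := He _ kn; have := Hg _ kn.
  set w := 2%:R * _ => gw dw.
  have pe_gt0 : (0 < p ^ logn p g)%N by rewrite expn_gt0 ltnW.
  (* Bezout makes the new multiple of [w] an integer combination of [g w] and [d p ^ e w], both
     integers. *)
  have [a b ab _] := egcdnP d pe_gt0.
  have cop : coprime (p ^ logn p g) d by rewrite coprimeXl // prime_coprime.
  have {ab}: (a * p ^ logn p g = b * d + 1)%N by rewrite ab (eqP cop).
  move=> ab.
  have -> : (u * p ^ e)%:R * w = (a * p ^ e)%:R * (g%:R * w)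
      - (b * u)%:R * (d%:R * ((p ^ e)%:R * w)).
    rewrite gE.
    have : (a * p ^ logn p g)%:R = (b * d + 1)%:R :> algC by rewrite ab.
    rewrite natrD !natrM => abR.
    transitivity ((a%:R * (p ^ logn p g)%:R - b%:R * d%:R) * (u%:R * (p ^ e)%:R) * w).
      by rewrite abR; ring.
    by ring.
  by rewrite rpredB // rpredM // rpred_nat.
move/g_min; rewrite {1}gE leq_pmul2l // leqNgt => /negP; apply.
by rewrite ltn_exp2l.
Qed.

(** If [gamma n = u p ^ v] with [v <= e], then [2 u] is prime to [p] and witnesses integrality; the
    2 is the constant factor in [G]. *)
Lemma lt_logn_gamma p n e k : prime p -> odd p -> (k < n./2)%N ->
  ~ integral_at p ((p ^ e)%:R * weight_sum n (2 * k).+1) ->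
  (e < logn p (gamma n))%N.
Proof.
move=> p_pr p_odd kn He; rewrite ltnNge; apply/negP => le_e; apply: He.
move: le_e; rewrite /gamma; case: ex_minnP => g /clears_denominatorsE[g_gt0 Hg] _ le_e.
have [u pu gE] := pfactor_coprime p_pr g_gt0.
set v := logn p g in gE le_e.
exists (2 * u)%N.
  rewrite Euclid_dvdM // negb_or -!prime_coprime // pu andbT.
  by rewrite coprimen2.
set w := weight_sum _ _.
have -> : (2 * u)%:R * ((p ^ e)%:R * w) = (p ^ (e - v))%:R * (g%:R * (2%:R * w)).
  by rewrite gE -{1}(subnK le_e) expnD !natrM; ring.
by rewrite rpredM ?rpred_nat ?Hg.
Qed.

(** * Reduction to the terms [m = c.+1 * p ^ e], where [p ^ e / m = 1 / c.+1] *)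

Definition top_sum (p e n s : nat) : algC :=
  \sum_(0 <= c < n %/ p ^ e) 'C(n - c.+1 * p ^ e, s)%:R / c.+1%:R.

Lemma integral_at_weight_sumD p e n s : prime p ->
  integral_at p ((p ^ e)%:R * weight_sum n s.+1 + top_sum p e n s).
Proof.
move=> p_pr; rewrite weight_sumE.
have C_int : integral_at p ((p ^ e)%:R * 'C(n, s.+1)%:R).
  by apply: integral_atM => //; apply: integral_at_nat.
have := integral_at_sum_inv p_pr e (fun m => 'C(n - m, s)) n.
move/(integral_atM p_pr (integral_at_nat p_pr p))/(integral_atB p_pr C_int).
congr (integral_at _ _); rewrite -/(top_sum p e n s) mulrBr.
have p_neq0 : p%:R != 0 :> algC by rewrite pnatr_eq0 -lt0n prime_gt0.
by field.
Qed.

(** Makes integrality of [p ^ e] times the coefficient equivalent to that of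
    [top_sum p e.+1 n s / p%:R]. *)
Lemma integral_at_weight_sumD_div p e n s : prime p ->
  integral_at p ((p ^ e)%:R * weight_sum n s.+1 + top_sum p e.+1 n s / p%:R).
Proof.
move=> p_pr; rewrite weight_sumE.
have C_int : integral_at p ((p ^ e)%:R * 'C(n, s.+1)%:R).
  by apply: integral_atM => //; apply: integral_at_nat.
have := integral_at_sum_inv p_pr e.+1 (fun m => 'C(n - m, s)) n.
move/(integral_atB p_pr C_int); congr (integral_at _ _).
rewrite -/(top_sum p e.+1 n s) expnS natrM mulrBr.
have p_neq0 : p%:R != 0 :> algC by rewrite pnatr_eq0 -lt0n prime_gt0.
by field.
Qed.

(** The largest power of [p] up to [n] has fewer than [p] multiples up to [n], so every denominator
    [c.+1] is prime to [p]. *)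
Lemma logn_gamma_le_trunc_log p n : prime p ->
  (logn p (gamma n) <= trunc_log p n)%N.
Proof.
move=> p_pr; apply: logn_gamma_le => // k _; rewrite mulrCA.
apply: integral_atM => //; first exact: integral_at_nat.
set e := trunc_log p n.
rewrite -[_ * _](addrK (top_sum p e n (2 * k))).
apply: integral_atB => //; first exact: integral_at_weight_sumD.
rewrite /top_sum big_nat; apply: big_ind => [|x y|c /andP[_ c_lt]].
- exact: integral_at_nat p_pr 0.
- exact: integral_atD.
apply: integral_atM => //; first exact: integral_at_nat.
apply: integral_at_natV => //; apply: contraL c_lt => /(dvdn_leq (ltn0Sn c)) le_pc.
rewrite -leqNgt -ltnS (leq_trans _ le_pc) // ltn_divLR ?expn_gt0 ?prime_gt0 //.
by rewrite -expnS trunc_log_ltn // prime_gt1.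
Qed.

Lemma logn_gamma_le_top_sum p n e : prime p ->
  (forall k, (k < n./2)%N -> integral_at p (top_sum p e.+1 n (2 * k) / p%:R)) ->
  (logn p (gamma n) <= e)%N.
Proof.
move=> p_pr He; apply: logn_gamma_le => // k kn; rewrite mulrCA.
apply: integral_atM => //; first exact: integral_at_nat.
have := integral_at_weight_sumD_div e n (2 * k) p_pr.
by move/(fun H => integral_atB p_pr H (He k kn)); rewrite addrK.
Qed.

Lemma lt_logn_gamma_top_sum p n e k : prime p -> odd p -> (k < n./2)%N ->
  ~ integral_at p (top_sum p e.+1 n (2 * k) / p%:R) -> (e < logn p (gamma n))%N.
Proof.
move=> p_pr p_odd kn He; apply: (lt_logn_gamma p_pr p_odd kn) => Hw; apply: He.
have := integral_at_weight_sumD_div e n (2 * k) p_pr.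
by move/(fun H => integral_atB p_pr H Hw); rewrite addrAC subrr add0r.
Qed.

(** * The case of two multiples, and the prime 3 *)

Lemma integral_at_top_sum2 p e n s : prime p -> odd p -> (n %/ p ^ e = 2)%N ->
  integral_at p (top_sum p e n s / p%:R) <->
  (p %| 2 * 'C(n - p ^ e, s) + 'C(n - 2 * p ^ e, s))%N.
Proof.
move=> p_pr p_odd n2; rewrite /top_sum n2 !big_nat_recr //= big_geq // add0r mul1n divr1.
have two_ndvd : ~~ (p %| 2)%N by rewrite -prime_coprime // coprimen2.
have p_neq0 : p%:R != 0 :> algC by rewrite pnatr_eq0 -lt0n prime_gt0.
set a := 'C(_, _); set b := 'C(_, _); split=> [H|/dvdnP[c abE]].
  apply: integral_at_divp => //.
  (* Doubling clears the second denominator; the converse divides by 2, a unit at odd [p]. *)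
  have := integral_atM p_pr (integral_at_nat p_pr 2) H.
  by congr (integral_at _ _); rewrite natrD natrM; field.
have -> : (a%:R + b%:R / 2%:R) / p%:R = c%:R * 2%:R^-1 :> algC.
  have : (2 * a + b)%:R = (c * p)%:R :> algC by rewrite abE.
  rewrite natrD !natrM => abR.
  transitivity ((2%:R * a%:R + b%:R) / 2%:R / p%:R : algC); first by field.
  by rewrite abR; field.
apply: integral_atM; first by [].
  exact: integral_at_nat.
exact: integral_at_natV.
Qed.

(* The witness [2 * k] is [t + 3 ^ e] for odd [t] and [t + 3 ^ e - 3 ^ v] for even [t],
   where [v] is the 3-adic valuation of [t + 3 ^ e], which is less than [e]. *)
Lemma ex_even_bin_ndvd3 e t : (0 < t < 3 ^ e)%N ->
  exists k, [/\ (t < 2 * k)%N, (2 * k <= t + 3 ^ e)%N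
              & ~~ (3 %| 'C(t + 3 ^ e, 2 * k))%N].
Proof.
move=> /andP[t_gt0 t_lt]; set q := (3 ^ e)%N in t_lt *.
have q_odd : odd q by rewrite oddX orbT.
have [t_odd|t_even] := boolP (odd t).
  exists (t + q)./2.
  have -> : (2 * (t + q)./2 = t + q)%N.
    by rewrite mul2n even_halfK // oddD t_odd q_odd.
  by rewrite binn leqnn; split=> //; lia.
set v := logn 3 (t + q).
have pv_tq : (3 ^ v %| t + q)%N by apply: pfactor_dvdnn.
have lt_ve : (v < e)%N.
  rewrite ltnNge; apply/negP=> le_ev.
  have : (q %| t + q)%N by apply: dvdn_trans pv_tq; rewrite dvdn_exp2l.
  by rewrite dvdn_addl // => /(dvdn_leq t_gt0); rewrite leqNgt t_lt.
have pv_t : (3 ^ v <= t)%N.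
  by apply: dvdn_leq => //; rewrite -(dvdn_addl _ (dvdn_exp2l 3 (ltnW lt_ve))).
exists (t + q - 3 ^ v)./2.
have -> : (2 * (t + q - 3 ^ v)./2 = t + q - 3 ^ v)%N.
  rewrite mul2n even_halfK // oddB; last by lia.
  by rewrite oddD (negPf t_even) q_odd oddX orbT.
(* By symmetry this is [C(t + q, 3 ^ v)], with [3 ^ v] the exact power of 3 in [t + q]. *)
rewrite bin_sub; last by lia.
have v_lt : (3 ^ v < q)%N by apply: leq_ltn_trans t_lt.
split; [|exact: leq_subr|by apply: prime_ndvd_bin_logn => //; rewrite addn_gt0 t_gt0].
by rewrite -addnBA ?(ltnW v_lt) // -[X in (X < _)%N]addn0 ltn_add2l subn_gt0.
Qed.

Theorem theorem5p9 (n : nat) (hn : (1 <= n)%N) :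
  ((exists m : nat, (1 <= m)%N /\ n = (2 * 3 ^ m)%N) ->
     logn 3 (gamma n) = (logn 3 (lcm_upto n) - 1)%N)
  /\
  (~ (exists m : nat, (1 <= m)%N /\ n = (2 * 3 ^ m)%N) ->
     logn 3 (gamma n) = logn 3 (lcm_upto n)).
Proof.
have p3 : prime 3 by [].
rewrite logn_lcm_upto //; split=> [[[|e] [// _ nE]]|not_special].
  have q_gt0 : (0 < 3 ^ e.+1)%N by rewrite expn_gt0.
  have -> : trunc_log 3 n = e.+1.
    by apply: trunc_log_eq => //; rewrite nE (expnS 3 e.+1); lia.
  rewrite subn1 /=; apply/eqP; rewrite eqn_leq; apply/andP; split.
    apply: logn_gamma_le_top_sum => // k kn.
    have n2 : (n %/ 3 ^ e.+1 = 2)%N by rewrite nE mulnK.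
    apply/integral_at_top_sum2 => //.
    have -> : (n - 3 ^ e.+1 = 3 ^ e.+1)%N by rewrite nE; lia.
    rewrite -nE subnn.
    (* For [k = 0] the value is [2 + 1 = 3]. For [k > 0] the second binomial vanishes and 3 divides
       the first, since [2 * k] cannot equal an odd power. *)
    have [->//|k_gt0] := posnP k; first by rewrite muln0 !bin0.
    rewrite (@bin_small 0) ?addn0; last by lia.
    apply: dvdn_mull.
    have [lt_k|lt_k|eq_k] := ltngtP (2 * k) (3 ^ e.+1).
    - by apply: (@prime_dvd_bin_pow _ _ e.+1); rewrite // lt_k; lia.
    - by rewrite bin_small.
    - by have := congr1 odd eq_k; rewrite oddX oddM.
  (* For [n = 6] the lower bound is 0. Otherwise the next smaller power has six multiples up to
     [n]. *)
  case: e => // e in nE q_gt0 *.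
  apply: (@lt_logn_gamma_top_sum 3 n e 0) => //; first by lia.
  have n6 : (n %/ 3 ^ e.+1 = 6)%N.
    by rewrite nE expnS mulnA mulnK // expn_gt0.
  rewrite /top_sum n6 !big_nat_recr //= big_geq // !bin0 => H.
  (* 20 is the denominator of [H_6 = 49 / 20], and 3 does not divide 49. *)
  have := integral_atM p3 (integral_at_nat p3 20) H.
  have -> : 20%:R * ((0 + 1 / 1 + 1 / 2%:R + 1 / 3%:R + 1 / 4%:R + 1 / 5%:R + 1 / 6%:R) / 3%:R)
     = 49%:R / 3%:R :> algC by field.
  by move/(integral_at_divp p3).
apply/eqP; rewrite eqn_leq logn_gamma_le_trunc_log //=.
have := trunc_log_bounds (isT : (1 < 3)%N) hn.
case: (trunc_log 3 n) => // e /andP[q_le n_lt].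
have q_gt0 : (0 < 3 ^ e)%N by rewrite expn_gt0.
have [n_lt2|n_ge2] := ltnP n (2 * 3 ^ e.+1).
  (* Only one multiple: the sum at [k = 0] is 1, and [1 / 3] is not integral at 3. *)
  apply: (@lt_logn_gamma_top_sum 3 n e 0) => //; first by rewrite expnS in q_le; lia.
  have n1 : (n %/ 3 ^ e.+1 = 1)%N.
    by apply/eqP; rewrite eqn_leq -ltnS ltn_divLR ?leq_divRL ?expn_gt0 ?mul1n ?n_lt2.
  rewrite /top_sum n1 big_nat1 bin0 divr1.
  by move/(integral_at_divp p3).
pose t := (n - 2 * 3 ^ e.+1)%N.
rewrite (expnS 3 e.+1) in n_lt.
have t_gt0 : (0 < t)%N.
  rewrite lt0n; apply/eqP => t0; apply: not_special; exists e.+1; split=> //.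
  by rewrite /t in t0; lia.
have [|k [lt_tk le_k ndvd]] := @ex_even_bin_ndvd3 e.+1 t.
  by rewrite t_gt0 /t; lia.
apply: (@lt_logn_gamma_top_sum 3 n e k) => //.
  by rewrite /t in le_k; rewrite expnS in le_k n_ge2; lia.
have n2 : (n %/ 3 ^ e.+1 = 2)%N.
  by apply/eqP; rewrite eqn_leq -ltnS ltn_divLR ?leq_divRL ?expn_gt0 ?n_lt ?n_ge2.
move/(integral_at_top_sum2 _ p3 isT n2).
(* As [t < 2 * k], only twice [C(t + 3 ^ e.+1, 2 * k)] remains. *)
rewrite -/t (bin_small lt_tk) addn0 Euclid_dvdM //=.
have -> : (n - 3 ^ e.+1 = t + 3 ^ e.+1)%N by rewrite /t; lia.
by rewrite (negPf ndvd).
Qed.
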